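(* Let $D=(V,A)$ be a digraph, $k$ a positive integer, and for every $v\in V$ let $M_v=(\delta^{in}_D(v),r_v)$ be a matroid on the set of arcs entering $v$. Then there exists a matroid-restricted $k$-arborescence in $D$ if and only if for every subpartition $\mathcal{X}$ of $V$ \[\sum_{X\in\mathcal{X}} r^\oplus(\delta^{in}_D(X))\ge k(|\mathcal{X}|-1).\]
   Context: $\delta^{in}_D(X)$ is the set of arcs of $D$ with head in $X$ and tail outside $X$. $r^\oplus$ is the rank function of the direct sum of the matroids $M_v$: $r^\oplus(E)=\sum_{v\in V} r_v(E\cap\delta^{in}_D(v))$ for $E\subseteq A$. A spanning arborescence is an arc set forming a spanning tree in the undirected sense with every in-degree at most one; a $k$-arborescence is the disjoint union of $k$ spanning arborescences. A $k$-arborescence $F$ is matroid-restricted if $F\cap\delta^{in}_D(v)$ is independent in $M_v$ for every $v\in V$. A subpartition of $V$ is a collection of pairwise disjoint nonempty subsets of $V$ (the empty collection included). *)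

(* Defs.v *)
From mathcomp Require Import all_boot all_order all_algebra.

Set Implicit Arguments.
Unset Strict Implicit.
Unset Printing Implicit Defensive.

(* Parallel arcs and loops are allowed. *)
Record digraph (V A : finType) := Digraph {
  tail : A -> V;
  head : A -> V
}.

(* The axioms constrain the rank function only on subsets of the ground set E;
   its values elsewhere are irrelevant. *)
Record matroid (T : finType) (E : {set T}) := Matroid {
  rk :> {set T} -> nat;
  rk_card : forall X : {set T}, X \subset E -> rk X <= #|X|;
  rk_mono : forall X Y : {set T}, X \subset Y -> Y \subset E -> rk X <= rk Y;
  rk_submod : forall X Y : {set T}, X \subset E -> Y \subset E ->
    rk (X :|: Y) + rk (X :&: Y) <= rk X + rk Y
}.

Definition indep (T : finType) (E : {set T}) (M : matroid E) (I : {set T}) :=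
  (I \subset E) && (M I == #|I|).

Section Digraphs.
Variables (V A : finType) (D : digraph V A).
Implicit Types (F : {set A}) (X : {set V}).

Definition delta_in X : {set A} :=
  [set a | (head D a \in X) && (tail D a \notin X)].

Definition adj F : rel V := fun u v =>
  [exists a in F, ((tail D a == u) && (head D a == v))
               || ((tail D a == v) && (head D a == u))].

Definition connected F := forall u v : V, connect (adj F) u v.

(* (a, true) traverses the arc a from tail to head, (a, false) from head to
   tail. *)
Definition src (d : A * bool) : V := if d.2 then tail D d.1 else head D d.1.
Definition dst (d : A * bool) : V := if d.2 then head D d.1 else tail D d.1.

(* Undirected cycles of the multigraph: a loop is a cycle of length 1, and two
   parallel or antiparallel arcs form a cycle of length 2. *)
Definition undirected_cycle F (c : seq (A * bool)) : bool :=
  [&& c != [::],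
      all (fun d => d.1 \in F) c,
      cycle (fun d d' => dst d == src d') c,
      uniq [seq d.1 | d <- c]
    & uniq [seq src d | d <- c]].

Definition acyclic F := forall c : seq (A * bool), ~~ undirected_cycle F c.

Definition spanning_tree F := connected F /\ acyclic F.

Definition spanning_arborescence F :=
  spanning_tree F /\ forall v : V, #|F :&: delta_in [set v]| <= 1.

Definition k_arborescence (k : nat) F :=
  exists T : 'I_k -> {set A},
    [/\ forall i, spanning_arborescence (T i),
        forall i j, i != j -> [disjoint T i & T j]
      & F = \bigcup_i T i].

Definition subpartition (P : {set {set V}}) : bool :=
  trivIset P && (set0 \notin P).

Variable M : forall v : V, matroid (delta_in [set v]).

Definition rk_sum (E : {set A}) : nat :=
  \sum_(v : V) M v (E :&: delta_in [set v]).

Definition matroid_restricted F :=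
  forall v : V, indep (M v) (F :&: delta_in [set v]).

End Digraphs.

(* Main.v *)
Require Import Defs.
From mathcomp Require Import all_boot all_order all_algebra.
From mathcomp Require Import zify.

(** Let [f X := rk_sum M (delta_in D X)], a submodular function on vertex sets.

    Sufficiency.  (1) A minimal multiset [s] of vertices such that
    [f X + |s \cap X| >= k] for every nonempty [X] has size at most [k]: each
    element of [s] lies in a tight set, maximal tight sets are pairwise disjoint
    by uncrossing, and the hypothesis applies to them.  (2) Matroid-intersection
    style deletion and contraction yields an independent arc set [F] that still
    satisfies [|F \cap delta_in D X| + |s \cap X| >= k].  (3) Growing [k]
    arborescences from the roots in [s] as in Lovasz's proof of Edmonds'
    disjoint arborescences theorem exhausts all vertices.

    Necessity.  In a spanning arborescence at most one member of a
    subpartition is not entered. *)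

Set Implicit Arguments.
Unset Strict Implicit.
Unset Printing Implicit Defensive.

(** * Choice of the roots *)

Section RootChoice.
Variables (V : finType) (k : nat) (f : {set V} -> nat).
Hypothesis f_submod : forall X Y : {set V},
  X :&: Y != set0 -> f (X :|: Y) + f (X :&: Y) <= f X + f Y.
Hypothesis f_subpart : forall P : {set {set V}},
  subpartition P -> k * #|P| <= k + \sum_(X in P) f X.

Definition covers (s : seq V) : bool :=
  [forall X : {set V}, (X != set0) ==> (k <= f X + count (mem X) s)].

Lemma coversP (s : seq V) :
  reflect (forall X : {set V}, X != set0 -> k <= f X + count (mem X) s)
          (covers s).
Proof.
apply: (iffP forallP) => H X; first by move=> X0; move/implyP: (H X); apply.
by apply/implyP; apply: H.
Qed.

Lemma count_setUI (X Y : {set V}) (s : seq V) :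
  count (mem (X :|: Y)) s + count (mem (X :&: Y)) s
    = count (mem X) s + count (mem Y) s.
Proof.
rewrite -[RHS]count_predUI; congr (_ + _); apply: eq_count => x /=;
by rewrite !inE.
Qed.

Lemma covers_rem (s : seq V) : covers s -> k < size s ->
  exists2 v, v \in s & covers (rem v s).
Proof.
move=> /coversP cs ks.
case: (boolP (has (fun v => covers (rem v s)) s)) => [/hasP //|/hasPn Hn].
pose tight (X : {set V}) := (X != set0) && (f X + count (mem X) s == k).
pose P := [set X | maxset tight X].
(* The union and the intersection each reach [k], and submodularity bounds their total by [2k]. *)
have tU X Y : tight X -> tight Y -> X :&: Y != set0 -> tight (X :|: Y).
  move=> /andP[X0 /eqP tX] /andP[Y0 /eqP tY] XY0.
  have U0 : X :|: Y != set0.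
    by apply: contraNneq X0 => /eqP; rewrite setU_eq0 => /andP[].
  have := f_submod XY0; have := count_setUI X Y s.
  have := cs _ XY0; have := cs _ U0.
  by rewrite /tight U0 /=; lia.
have Ptight X : X \in P -> tight X.
  by rewrite inE => /maxsetP[].
have sP : subpartition P.
  apply/andP; split; last by apply/negP => /Ptight; rewrite /tight eqxx.
  apply/trivIsetP => X Y XP YP; apply: contraNT; rewrite -setI_eq0 => XY0.
  have tXY := tU _ _ (Ptight _ XP) (Ptight _ YP) XY0.
  move: XP YP; rewrite !inE => /maxsetP[_ mX] /maxsetP[_ mY].
  by rewrite -(mX _ tXY (subsetUl X Y)) {1}(mY _ tXY (subsetUr X Y)).
(* A set no longer covered after removing [v] contains [v] and was tight. *)
have cov v : v \in s -> exists2 X, X \in P & v \in X.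
  move=> vs; have /forallPn[X] := Hn _ vs.
  rewrite negb_imply -ltnNge => /andP[X0 ltk].
  have := cs _ X0; have /permP/(_ (mem X)) /= := perm_to_rem vs => cX leX.
  have vX : v \in X.
    by move: cX ltk leX; case: (v \in X) => //= ->; lia.
  have tX : tight X.
    by rewrite /tight X0 /=; move: cX ltk leX; rewrite vX; lia.
  have [Y mY XY] := maxset_exists tX.
  by exists Y; [rewrite inE | apply: (subsetP XY)].
have sumk : \sum_(X in P) f X + \sum_(X in P) count (mem X) s = k * #|P|.
  rewrite -big_split (eq_bigr (fun=> k)); first by rewrite sum_nat_const mulnC.
  by move=> X /Ptight/andP[_ /eqP].
have les : size s <= \sum_(X in P) count (mem X) s.
  rewrite (eq_bigr (fun X : {set V} => \sum_(v <- s) (v \in X : nat))).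
    rewrite exchange_big /= -sum1_size big_seq [leqRHS]big_seq.
    apply: leq_sum => v /cov[X XP vX].
    by rewrite (bigD1 X) //= vX.
  by move=> X _; rewrite -sum1_count big_mkcond.
have := f_subpart sP; rewrite -sumk addnC leq_add2r => lek.
by have := leq_trans les lek; rewrite leqNgt ks.
Qed.

Lemma covers_small : exists2 s, covers s & size s <= k.
Proof.
suff H n : forall s, covers s -> size s <= n -> exists2 s', covers s' & size s' <= k.
  (* Taking every vertex [k] times covers every nonempty set, whatever [f] is. *)
  have := H _ (flatten (nseq k (enum V))) _ (leqnn _); apply.
  apply/coversP => X /set0Pn[x xX].
  rewrite count_flatten map_nseq sumn_nseq.
  apply: leq_trans (leq_addl _ _); apply: leq_pmull.
  by rewrite -has_count; apply/hasP; exists x; rewrite ?mem_enum.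
elim: n => [|n IH] s cs les; first by exists s => //; lia.
have [|ks] := leqP (size s) k; first by exists s.
have [v vs crem] := covers_rem cs ks.
by apply: IH crem _; rewrite size_rem // -subn1 leq_subLR add1n.
Qed.

End RootChoice.

(** * Cuts of a digraph and the rank function of the direct sum *)

Section Digraph.
Variables (V A : finType) (D : digraph V A).
Implicit Types (F I R T : {set A}) (X Y : {set V}) (a e : A).

Local Notation dlt := (delta_in D).
Local Notation hd := (Defs.head D).
Local Notation tl := (Defs.tail D).

Lemma card_setI_sum (E F : {set A}) : #|E :&: F| = \sum_(a in E) (a \in F : nat).
Proof.
rewrite -sum1_card big_mkcond [RHS]big_mkcond; apply: eq_bigr => a _.
by rewrite in_setI; case: (a \in E); case: (a \in F).
Qed.

Lemma card_delta_submod F X Y :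
  #|F :&: dlt (X :|: Y)| + #|F :&: dlt (X :&: Y)|
    <= #|F :&: dlt X| + #|F :&: dlt Y|.
Proof.
rewrite !card_setI_sum -!big_split; apply: leq_sum => a _; rewrite !inE.
by do 4![case: (_ \in _)].
Qed.

Lemma delta_inT : dlt setT = set0.
Proof. by apply/setP => a; rewrite !inE. Qed.

Section Rank.
Variable M : forall v : V, matroid (dlt [set v]).
Local Notation r := (rk_sum M).

Lemma rk_vertex_mono v F F' :
  {in F, forall a, hd a = v -> a \in F'} ->
  M v (F :&: dlt [set v]) <= M v (F' :&: dlt [set v]).
Proof.
move=> H; apply: rk_mono; last exact: subsetIr.
apply/subsetP => a /setIP[aF av]; rewrite in_setI av andbT H //.
by move: av; rewrite !inE => /andP[/eqP].
Qed.

Lemma rk_vertex_submod v F F' :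
  M v ((F :|: F') :&: dlt [set v]) + M v ((F :&: F') :&: dlt [set v])
    <= M v (F :&: dlt [set v]) + M v (F' :&: dlt [set v]).
Proof. by rewrite setIUl setIIl; apply: rk_submod; apply: subsetIr. Qed.

Lemma rk_sum_mono F F' : F \subset F' -> r F <= r F'.
Proof.
move=> /subsetP H; apply: leq_sum => v _; apply: rk_vertex_mono => a aF _.
exact: H.
Qed.

Lemma rk_sum_submod F F' : r (F :|: F') + r (F :&: F') <= r F + r F'.
Proof.
by rewrite -!big_split; apply: leq_sum => v _; apply: rk_vertex_submod.
Qed.

(** A non-loop arc enters exactly one singleton, that of its head; a loop enters none. *)
Lemma sum_card_delta F :
  \sum_(v : V) #|F :&: dlt [set v]| = #|[set a in F | tl a != hd a]|.
Proof.
rewrite (eq_bigr (fun v => \sum_(a in F | tl a != hd a)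
                               (hd a == v : nat))).
  rewrite exchange_big /= -sum1_card; apply: eq_big => [a|a _].
    by rewrite inE.
  rewrite (bigD1 (hd a)) //= eqxx big1 ?addn0 // => v.
  by rewrite eq_sym => /negbTE ->.
move=> v _; rewrite -sum1_card big_mkcond [RHS]big_mkcond.
apply: eq_bigr => a _; rewrite !inE.
case: (a \in F) => //=; case: (eqVneq (hd a) v) => [->|_] /=.
  by case: ifP.
by case: ifP.
Qed.

Lemma rk_sum_card F : r F <= #|F|.
Proof.
apply: (@leq_trans (\sum_(v : V) #|F :&: dlt [set v]|)).
  by apply: leq_sum => v _; apply: rk_card; apply: subsetIr.
rewrite sum_card_delta; apply: subset_leq_card.
by apply/subsetP => a; rewrite inE => /andP[].
Qed.

(** Rank is at most cardinality at each vertex, so equality of the totals forces equality at every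
    vertex. *)
Lemma matroid_restrictedP F : #|F| <= r F -> matroid_restricted M F.
Proof.
move=> leF v; rewrite /indep subsetIr /=.
have lev w : M w (F :&: dlt [set w]) <= #|F :&: dlt [set w]|.
  by apply: rk_card; apply: subsetIr.
rewrite eqn_leq lev /=.
have le1 : \sum_(w : V) #|F :&: dlt [set w]| <= r F.
  apply: leq_trans leF; rewrite sum_card_delta; apply: subset_leq_card.
  by apply/subsetP => a; rewrite inE => /andP[].
move: le1; rewrite /rk_sum (bigD1 v) //= [leqRHS](bigD1 v) //=.
have : \sum_(w | w != v) M w (F :&: dlt [set w])
         <= \sum_(w | w != v) #|F :&: dlt [set w]|.
  by apply: leq_sum.
by lia.
Qed.

Lemma matroid_restricted_sub F F' :
  F' \subset F -> matroid_restricted M F -> matroid_restricted M F'.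
Proof.
move=> FF' iF v; rewrite /indep subsetIr /=.
have /andP[_ /eqP iv] := iF v.
set B := F :&: _ in iv; set B' := F' :&: _.
have sB : B \subset dlt [set v] by apply: subsetIr.
have sB' : B' \subset dlt [set v] by apply: subsetIr.
have BB' : B' \subset B by apply: setSI.
have sD : B :\: B' \subset dlt [set v] := subset_trans (subsetDl _ _) sB.
have := rk_submod (M v) sB' sD.
have -> : B' :|: B :\: B' = B by rewrite -{1}(setIidPr BB') setID.
rewrite iv.
have := rk_card (M v) sB'; have := rk_card (M v) sD.
by rewrite (cardsD B) (setIidPr BB'); have := subset_leq_card BB'; lia.
Qed.

(* [a], [b] are the sets attached to [X], [Y], while [c], [d] are those attached
   to [X :&: Y], [X :|: Y].  Submodularity is used only at vertices of
   [X :&: Y]; at the others [{a, b}] dominates [{c, d}] termwise. *)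
Lemma rk_sum_uncross X Y (a b c d : {set A}) :
    {subset c <= a :|: b} ->
    {in c, forall x, hd x \notin X -> x \in a} ->
    {in c, forall x, hd x \in X -> hd x \notin Y -> x \in b} ->
    {in d, forall x, hd x \in X -> x \in a} ->
    {in d, forall x, (hd x \in X) ==> (hd x \in Y) -> x \in b} ->
  r c + r d <= r a + r b.
Proof.
move=> cab ca cb da db; rewrite -!big_split; apply: leq_sum => v _ /=.
have [vX|vX] := boolP (v \in X); last first.
  apply: leq_add; apply: rk_vertex_mono => x + hx.
    by move/ca; apply; rewrite hx.
  by move/db; apply; rewrite hx (negbTE vX).
have [vY|vY] := boolP (v \in Y); last first.
  rewrite addnC; apply: leq_add; apply: rk_vertex_mono => x + hx.
    by move/da; apply; rewrite hx.
  by move/cb; apply; rewrite hx.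
apply: leq_trans (rk_vertex_submod v a b); apply: leq_add;
  apply: rk_vertex_mono => x xF hx; first exact: cab.
by rewrite in_setI da ?db // hx ?vX ?vY.
Qed.

Lemma rk_sum_delta_submod X Y :
  r (dlt (X :|: Y)) + r (dlt (X :&: Y)) <= r (dlt X) + r (dlt Y).
Proof.
rewrite addnC; apply: (@rk_sum_uncross X Y) => x; rewrite !inE;
  by do 4![case: (_ \in _)].
Qed.

(** * An independent arc set meeting the cut demands *)

Section IndependentCover.
Variables (k : nat) (m : {set V} -> nat).
Hypothesis m_submod : forall X Y, m (X :|: Y) + m (X :&: Y) <= m X + m Y.

(* [I] is contracted and the arcs outside [I :|: R] are deleted. *)
Definition extendable I R : bool :=
  (#|I| <= r I) &&
  [forall X, (X != set0) ==>
     (k + #|I| <= r (I :|: R :&: dlt X) + #|I :&: dlt X| + m X)].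

(** If [Y] blocks the deletion and [X] the contraction, then [e] enters [Y] and has both ends in
    [X]. Uncrossing contradicts the inequalities at [X :&: Y] and [X :|: Y], since the two failures
    together fall short by one. *)
Lemma extendable_step I R e : e \in R -> e \notin I -> extendable I R ->
  extendable I (R :\ e) || extendable (e |: I) (R :\ e).
Proof.
move=> eR eI /andP[leI /forallP cov].
have ext X : X != set0 ->
    k + #|I| <= r (I :|: R :&: dlt X) + #|I :&: dlt X| + m X.
  by move=> X0; apply: (implyP (cov X)).
case: (boolP (extendable I (R :\ e))) => //=; rewrite /extendable leI /=.
move=> /forallPn[Y]; rewrite negb_imply -ltnNge => /andP[Y0 failY].
have eY : e \in dlt Y.
  apply: contraLR failY => eY; rewrite -leqNgt.
  suff -> : (R :\ e) :&: dlt Y = R :&: dlt Y by apply: ext.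
  by apply/setP => x; rewrite !inE; case: eqVneq => //= ->;
    rewrite !inE in eY; rewrite (negbTE eY) andbF.
have [hY tY] : hd e \in Y /\ tl e \notin Y.
  by move: eY; rewrite inE => /andP.
have cardI : #|e |: I| = #|I|.+1 by rewrite cardsU1 eI.
(* If [I] spans [e], deleting [e] does not lower the rank term, so it would succeed at [Y]. *)
have indep_eI : #|e |: I| <= r (e |: I).
  rewrite leqNgt cardI ltnS; apply: contraL failY => reI; rewrite -leqNgt.
  apply: leq_trans (ext _ Y0) _; rewrite !leq_add2r.
  have := rk_sum_submod (I :|: (R :\ e) :&: dlt Y) (e |: I).
  have := @rk_sum_mono (I :|: R :&: dlt Y)
            ((I :|: (R :\ e) :&: dlt Y) :|: (e |: I)).
  have := @rk_sum_mono I ((I :|: (R :\ e) :&: dlt Y) :&: (e |: I)).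
  have -> : I \subset (I :|: (R :\ e) :&: dlt Y) :&: (e |: I).
    by apply/subsetP => x xI; rewrite !inE xI orbT.
  have -> : I :|: R :&: dlt Y \subset
              (I :|: (R :\ e) :&: dlt Y) :|: (e |: I).
    by apply/subsetP => x; rewrite !inE; case: (x == e); rewrite /= ?orbT //
      => ->.
  by move=> /(_ isT) h1 /(_ isT) h2 h3; lia.
rewrite indep_eI /=; apply/forallP => X; apply/implyP => X0.
rewrite leqNgt; apply/negP => failX; rewrite cardI in failX.
have le_eI : #|I :&: dlt X| <= #|(e |: I) :&: dlt X|.
  by apply: subset_leq_card; apply: setSI; apply: subsetUr.
(* If [e] entered [X], the growth of [I :&: dlt X] would pay for the growth of [#|I|]. *)
have neX : e \notin dlt X.
  apply/negP => eX.
  have : #|I :&: dlt X| < #|(e |: I) :&: dlt X|.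
    apply: proper_card; apply/properP; split; first by rewrite setSI ?subsetUr.
    by exists e; rewrite in_setI eX ?setU11 // (negbTE eI).
  have := @rk_sum_mono (I :|: R :&: dlt X) ((e |: I) :|: (R :\ e) :&: dlt X).
  have -> : I :|: R :&: dlt X \subset (e |: I) :|: (R :\ e) :&: dlt X.
    by apply/subsetP => x; rewrite !inE; case: (x == e).
  by move=> /(_ isT); have := ext _ X0; lia.
(* If [hd e] is outside [X], no arc of [dlt X] shares it, so adding [e] raises the rank term as much
   as it raises [r I], by at least one. *)
have hX : hd e \in X.
  apply: contraLR (leqnn 0) => hX; exfalso.
  have : r (I :|: R :&: dlt X) + r (e |: I) <=
         r ((e |: I) :|: (R :\ e) :&: dlt X) + r I.
    rewrite -!big_split; apply: leq_sum => v _ /=.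
    case: (eqVneq (hd e) v) => [hv|hv]; last first.
      apply: leq_add; apply: rk_vertex_mono => x; rewrite !inE.
        by case: (x == e).
      by move=> + hx; case: eqVneq => // xe; move: hv; rewrite -xe hx eqxx.
    rewrite addnC; apply: leq_add; apply: rk_vertex_mono => x.
      by rewrite !inE => /orP[] ->; rewrite ?orbT.
    by rewrite !inE => + hx; rewrite hx -hv (negbTE hX) andbF orbF.
  by have := ext _ X0; have := rk_sum_card I; lia.
have tX : tl e \in X.
  by move: neX; rewrite inE hX /= negbK.
have XY0 : X :&: Y != set0 by apply/set0Pn; exists (hd e); rewrite inE hX hY.
have XU0 : X :|: Y != set0 by apply/set0Pn; exists (hd e); rewrite inE hX.
(* On the left [e] occurs only in the first term, as it enters [X :&: Y] but not [X :|: Y]; [e |: I]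
   accounts for it on the right. *)
have : r (I :|: R :&: dlt (X :&: Y)) + r (I :|: R :&: dlt (X :|: Y)) <=
       r ((e |: I) :|: (R :\ e) :&: dlt X) + r (I :|: (R :\ e) :&: dlt Y).
  apply: (@rk_sum_uncross X Y) => x; rewrite !inE;
    case: (eqVneq x e) => [->|_]; rewrite ?eR ?hX ?hY ?tX ?(negbTE tY) ?(negbTE eI) ?orbT //=;
    by case: (x \in I); case: (x \in R); case: (hd x \in X);
      case: (hd x \in Y); case: (tl x \in X); case: (tl x \in Y).
have := card_delta_submod I X Y; have := m_submod X Y.
by have := ext _ XY0; have := ext _ XU0; lia.
Qed.

(** Arcs are processed one at a time from [I = set0], [R = setT]. Once [R] is empty, [r I] cancels
    [#|I|] and the cut inequality remains. *)
Lemma independent_cover :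
    (forall X, X != set0 -> k <= r (dlt X) + m X) ->
  exists2 F : {set A}, #|F| <= r F & forall X, X != set0 -> k <= #|F :&: dlt X| + m X.
Proof.
move=> cov.
suff H n : forall I R, #|R| = n -> [disjoint I & R] -> extendable I R ->
    exists2 F : {set A}, #|F| <= r F & forall X, X != set0 -> k <= #|F :&: dlt X| + m X.
  apply: (H _ set0 setT erefl); first by rewrite -setI_eq0 set0I.
  rewrite /extendable cards0 /=; apply/forallP => X; apply/implyP => X0.
  by rewrite addn0 set0I cards0 addn0 set0U setTI; apply: cov.
elim: n => [|n IH] I R cR dIR extIR.
  move/eqP: cR; rewrite cards_eq0 => /eqP R0.
  have /andP[leI /forallP H] := extIR; exists I => // X X0.
  have := implyP (H X) X0; rewrite R0 set0I setU0.
  by have := rk_sum_card I; lia.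
have /set0Pn[e eR] : R != set0 by rewrite -card_gt0 cR.
have eI : e \notin I by rewrite (disjointFl dIR eR).
have cRe : #|R :\ e| = n by have := cardsD1 e R; rewrite eR cR => -[].
have dI : [disjoint I & R :\ e].
  by apply: disjointWr dIR; apply: subsetDl.
case/orP: (extendable_step eR eI extIR) => [/IH|/IH]; apply => //.
by rewrite -setI_eq0 setIUl setU_eq0 setI_eq0 [_ :&: _ == _]setI_eq0 dI andbT
  disjoints1 !inE eqxx.
Qed.

End IndependentCover.
End Rank.

(** * Arborescences and the sets they enter *)

Section Arborescences.

Lemma adj_sym T : symmetric (adj D T).
Proof.
by move=> u v; apply/exists_inP/exists_inP => -[a aT H]; exists a => //;
  rewrite orbC.
Qed.

Lemma connect_adj_sub T T' : T \subset T' ->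
  subrel (connect (adj D T)) (connect (adj D T')).
Proof.
move=> /subsetP TT'; apply: connect_sub => u v /exists_inP[a aT H].
by apply: connect1; apply/exists_inP; exists a => //; apply: TT'.
Qed.

Lemma connect_closed (e : rel V) (S : {set V}) u v :
  (forall x y, x \in S -> e x y -> y \in S) ->
  u \in S -> connect e u v -> v \in S.
Proof.
move=> cl uS /connectP[p + ->]; elim: p u uS => //= x p IH u uS /andP[ux].
by apply: IH; apply: cl ux.
Qed.

(** Rooted arborescences with their vertex sets; since each new arc leaves the current set, the
    properties of an arborescence follow by induction. *)
Inductive grown : {set V} -> {set A} -> Prop :=
| Grown1 v : grown [set v] set0
| GrownS S T a of grown S T & tl a \in S & hd a \notin S :
    grown (hd a |: S) (a |: T).

Lemma grown_neq0 S T : grown S T -> S != set0.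
Proof.
case=> [v|S' T' a _ _ _]; apply/set0Pn; first by exists v; rewrite set11.
by exists (hd a); apply: setU11.
Qed.

Lemma grown_ends S T : grown S T ->
  {in T, forall a, (tl a \in S) /\ (hd a \in S)}.
Proof.
elim=> [v a /[!inE] //|{}S {}T a _ IH ta ha b].
by rewrite in_setU1 => /orP[/eqP->|/IH[tb hb]];
  rewrite !in_setU1 ?ta ?tb ?hb ?eqxx ?orbT.
Qed.

Lemma grown_connect S T : grown S T ->
  {in S &, forall u v, connect (adj D T) u v}.
Proof.
elim=> [v u w /set1P-> /set1P-> //|{}S {}T a _ IH ta ha].
have toa u : u \in hd a |: S -> connect (adj D (a |: T)) u (tl a).
  rewrite in_setU1 => /orP[/eqP->|uS].
    apply: connect1; apply/exists_inP; exists a; first exact: setU11.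
    by rewrite !eqxx orbT.
  by apply: (connect_adj_sub (subsetUr [set a] T)); apply: IH.
move=> u v /toa uc /toa; rewrite (sym_connect_sym (@adj_sym _)).
exact: connect_trans.
Qed.

Lemma grown_indegree S T v : grown S T -> #|T :&: dlt [set v]| <= 1.
Proof.
elim=> [w|{}S {}T a gT IH ta ha]; first by rewrite set0I cards0.
have [av|av] := eqVneq (hd a) v; last first.
  suff -> : (a |: T) :&: dlt [set v] = T :&: dlt [set v] by [].
  apply/setP => x; rewrite !inE; case: (eqVneq x a) => [->|//].
  by rewrite (negbTE av) !andbF.
suff /subset_leq_card : (a |: T) :&: dlt [set v] \subset [set a].
  by rewrite cards1.
apply/subsetP => x; rewrite !inE => /andP[/orP[//|/(grown_ends gT)[_ hx]]].
by case/andP=> /eqP xv; move: hx; rewrite xv -av (negbTE ha).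
Qed.

Lemma undirected_cycle_rot T c n :
  undirected_cycle D T (rot n c) = undirected_cycle D T c.
Proof.
rewrite /undirected_cycle -!size_eq0 size_rot rot_cycle !map_rot !rot_uniq.
by congr [&& _, _, _, _ & _]; apply: eq_all_r => x; rewrite mem_rot.
Qed.

(* A new arc has a degree-one endpoint, which no cycle through it can leave. *)
Lemma grown_acyclic S T : grown S T -> acyclic D T.
Proof.
elim=> [v|{}S {}T a gT IH ta ha] c; apply/negP.
  by case: c => // x c /and5P[_ /= /andP[]]; rewrite inE.
move=> cyc; have [/mapP[d dc da]|na] := boolP (a \in [seq x.1 | x <- c]); last first.
  have /negP := IH c; apply; move: cyc => /and5P[c0 /allP cT cc u1 u2].
  rewrite /undirected_cycle c0 cc u1 u2 !andbT /=; apply/allP => d dc.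
  have := cT _ dc; rewrite in_setU1 => /orP[/eqP da|//].
  by case/mapP: na; exists d.
have notT x : x.1 \in T -> (src D x != hd a) /\ (dst D x != hd a).
  move=> /(grown_ends gT)[tx hx]; rewrite /src /dst.
  by case: (x.2); split; apply: contraNneq ha => <-.
have loop : hd a != tl a by apply: contraNneq ha => ->.
move: cyc; case: (rot_to dc) => n c' ec.
rewrite -(undirected_cycle_rot _ _ n) ec => /and5P[_ /=].
case: d da {dc ec} => _ b /= <-.
case/lastP: c' => [|c' y] /andP[_ cT].
  by rewrite /= andbT /dst /src /=; case: b; rewrite ?(eq_sym (tl a)) (negbTE loop).
have inT x : x \in rcons c' y -> a \notin [seq z.1 | z <- rcons c' y] ->
    x.1 \in T.
  move=> xc /mapP nac; have := allP cT _ xc.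
  by rewrite in_setU1 => /orP[/eqP xa|//]; case: nac; exists x.
rewrite rcons_path => + /andP[nac _] _.
case: b => /= /andP[pth].
  have [z [l ez]] : exists z l, rcons c' y = z :: l.
    by case: (c') => [|z l]; [exists y, [::] | exists z, (rcons l y)].
  have zT : z.1 \in T by apply: inT => //; rewrite ez mem_head.
  by move: pth; rewrite ez /= {1}/dst /= eq_sym (negbTE (notT _ zT).1).
have yT : y.1 \in T by apply: inT => //; rewrite mem_rcons mem_head.
by rewrite last_rcons /src /= (negbTE (notT _ yT).2).
Qed.

Lemma grown_spanning T : grown setT T -> spanning_arborescence D T.
Proof.
move=> gT; split=> [|v]; last exact: grown_indegree gT.
split; last exact: grown_acyclic gT.
by move=> u v; apply: (grown_connect gT).
Qed.

(** Were neither set entered, the vertices reachable from [X] along directed arcs would be closed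
    under undirected adjacency, hence include [Y]; but a directed path from [X] cannot get into an
    unentered [Y]. *)
Lemma unentered_unique T X Y : spanning_arborescence D T ->
    X != set0 -> Y != set0 -> [disjoint X & Y] ->
  T :&: dlt X = set0 -> T :&: dlt Y != set0.
Proof.
move=> [[conT _] indeg] /set0Pn[x0 x0X] /set0Pn[y0 y0Y] dXY TX0.
apply/negP => /eqP TY0.
(* Directed steps along non-loop arcs, the ones that the in-degree bound counts. *)
pose e := [rel u v | [exists a in T :&: dlt [set v], tl a == u]].
have unentered Z a : T :&: dlt Z = set0 -> a \in T -> hd a \in Z -> tl a \in Z.
  move=> Z0 aT hZ; move/setP/(_ a): Z0; rewrite !inE aT hZ /=.
  by move/negbFE.
pose S := [set y | [exists x in X, connect e x y]].
have XS x : x \in X -> x \in S by move=> xX; rewrite inE; apply/exists_inP; exists x.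
have clS u v : u \in S -> adj D T u v -> v \in S.
  move=> uS /exists_inP[a aT /orP[]/andP[/eqP ta /eqP ha]].
    have [<- //|uv] := eqVneq u v.
    move: uS; rewrite !inE => /exists_inP[x xX xu]; apply/exists_inP.
    exists x => //; apply: connect_trans xu _; apply: connect1.
    by apply/exists_inP; exists a; rewrite ?inE ?aT ?ha ?ta ?eqxx.
  have [uX|uX] := boolP (u \in X).
    by apply: XS; rewrite -ta; apply: (unentered _ _ TX0); rewrite ?ha.
  (* Outside [X], [u] was reached through an arc [b]. The in-degree bound gives [a = b], so the tail
     [v] was reached before. *)
  apply: contraT => vS.
  move: (uS); rewrite inE => /exists_inP[x xX /connectP[p]].
  case/lastP: p => [_ ux|p w]; first by rewrite ux xX in uX.
  rewrite rcons_path last_rcons => /andP[pth /exists_inP[b bT /eqP tb]] uw.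
  rewrite -uw in bT.
  have wS : tl b \in S.
    rewrite tb inE; apply/exists_inP; exists x => //.
    by apply/connectP; exists p.
  have aT' : a \in T :&: dlt [set u].
    rewrite !inE aT ha ta eqxx /=; apply: contraNneq vS => ->; exact: uS.
  have := card_le1_eqP (indeg u) a b aT' bT => ab.
  by move: vS; rewrite -ta -ab wS.
have : y0 \in S by apply: connect_closed clS (XS _ x0X) (conT _ _).
rewrite inE => /exists_inP[x xX /(@connect_closed _ (~: Y)) cY].
have : y0 \in ~: Y; last by rewrite inE y0Y.
apply: cY; last by rewrite inE (disjointFr dXY xX).
move=> u v; rewrite !inE => uY /exists_inP[a]; rewrite !inE.
move=> /and3P[aT /eqP ha _] /eqP ta; apply: contra uY => vY.
by rewrite -ta; apply: (unentered _ _ TY0); rewrite ?ha.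
Qed.

(** All members but at most one contribute at least 1 to the sum. *)
Lemma subpartition_entered T (P : {set {set V}}) :
  spanning_arborescence D T -> subpartition P ->
  #|P| <= (\sum_(X in P) #|T :&: dlt X|).+1.
Proof.
move=> sT /andP[/trivIsetP tP nP].
have P0 X : X \in P -> X != set0 by apply: contraTneq => ->.
pose Q := [set X in P | T :&: dlt X == set0].
have Q1 : #|Q| <= 1.
  apply/card_le1_eqP => X Y; rewrite !inE => /andP[XP /eqP X0] /andP[YP Y0].
  apply: contraTeq Y0; rewrite eq_sym => XY.
  by apply: unentered_unique sT (P0 _ XP) (P0 _ YP) (tP _ _ XP YP XY) X0.
rewrite -addn1; apply: leq_trans (leq_add (leqnn _) Q1).
rewrite -!sum1_card [X in _ + X]big_mkcond /= [X in _ + X](bigID (mem P)) /=.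
rewrite [X in _ + (_ + X)]big1 ?addn0; last first.
  by move=> X /negbTE XP; rewrite inE XP.
rewrite -big_split; apply: leq_sum => X XP; rewrite inE XP /=.
by case: (eqVneq (T :&: dlt X)) => /=; [lia|rewrite -card_gt0; lia].
Qed.

End Arborescences.

(** * Edmonds' disjoint arborescences *)

Section Edmonds.
Variable k : nat.
Implicit Types (S : 'I_k -> {set V}) (i j : 'I_k).

(** Each partial tree missing [X] needs its own arc into [X]: this is the bound in Edmonds' cut
    condition. *)
Definition demand S X := #|[set i | [disjoint S i & X]]|.

Lemma demand_supermod S X Y :
  demand S X + demand S Y <= demand S (X :&: Y) + demand S (X :|: Y).
Proof.
rewrite /demand -cardsUI; apply: leq_add; apply: subset_leq_card;
  apply/subsetP => i; rewrite !inE.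
  by case/orP; apply: disjointWr; rewrite ?subsetIl ?subsetIr.
by rewrite -!setI_eq0 setIUr setU_eq0.
Qed.

(** The index [i] is counted at [X :&: Y] and at none of the other three sets. *)
Lemma demand_supermod_lt S X Y i :
    ~~ [disjoint S i & X] -> ~~ [disjoint S i & Y] ->
    [disjoint S i & X :&: Y] ->
  demand S X + demand S Y < demand S (X :&: Y) + demand S (X :|: Y).
Proof.
move=> iX iY iXY; rewrite /demand -cardsUI -addSn; apply: leq_add.
  apply: proper_card; apply/properP; split; last first.
    by exists i; rewrite !inE // negb_or iX.
  apply/subsetP => j; rewrite !inE.
  by case/orP; apply: disjointWr; rewrite ?subsetIl ?subsetIr.
apply: subset_leq_card; apply/subsetP => j; rewrite !inE.
by rewrite -!setI_eq0 setIUr setU_eq0.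
Qed.

Definition enlarge S i v j := if j == i then v |: S i else S j.

Lemma disjoint_enlarge S i v j X :
  [disjoint enlarge S i v j & X] -> [disjoint S j & X].
Proof.
rewrite /enlarge; case: eqVneq => [->|//]; apply: disjointWl.
exact: subsetUr.
Qed.

Lemma demand_enlarge S i v X : demand (enlarge S i v) X <= demand S X.
Proof.
by apply: subset_leq_card; apply/subsetP => j; rewrite !inE;
  apply: disjoint_enlarge.
Qed.

Lemma demand_enlarge_lt S i v X : v \in X -> [disjoint S i & X] ->
  demand (enlarge S i v) X < demand S X.
Proof.
move=> vX iX; apply: proper_card; apply/properP; split.
  by apply/subsetP => j; rewrite !inE; apply: disjoint_enlarge.
exists i; rewrite !inE // /enlarge eqxx -setI_eq0; apply/set0Pn; exists v.
by rewrite inE setU11.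
Qed.

(* Lovasz: take an arc inside a minimal tight set that meets [S i] without being
   contained in it; such sets exist since [setT] is one. *)
Lemma edmonds_step F S i : S i != set0 -> S i != setT ->
    (forall X, X != set0 -> demand S X <= #|F :&: dlt X|) ->
  exists e, [/\ e \in F, tl e \in S i, hd e \notin S i &
    forall X, X != set0 ->
      demand (enlarge S i (hd e)) X <= #|(F :\ e) :&: dlt X|].
Proof.
move=> Si0 SiT cov.
pose critical X := [&& demand S X == #|F :&: dlt X|, ~~ [disjoint S i & X]
                     & ~~ (X \subset S i)].
have critT : critical setT.
  rewrite /critical delta_inT setI0 cards0 subTset SiT andbT.
  rewrite -setI_eq0 setIT Si0 andbT.
  have := cov setT; rewrite delta_inT setI0 cards0 leqn0; apply.
  by apply: contraNneq Si0 => T0; rewrite -subset0 -T0 subsetT.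
have [X /minsetP[/and3P[/eqP tX iX nX] minX] _] := minset_exists critT.
have XS0 : X :\: S i != set0 by rewrite setD_eq0.
(* [S i] meets [X] but not [X :\: S i]. The extra demand yields an arc entering the smaller set and
   not [X], so its tail is in [X] and in [S i]. *)
have ltd : demand S X < demand S (X :\: S i).
  apply: proper_card; apply/properP; split.
    apply/subsetP => j; rewrite !inE; apply: disjointWr; exact: subsetDl.
  exists i; rewrite !inE // -setI_eq0.
  by apply/eqP/setP => x; rewrite !inE; case: (x \in S i).
have /subsetPn[e] : ~~ (F :&: dlt (X :\: S i) \subset F :&: dlt X).
  apply/negP => /subset_leq_card; have := cov _ XS0; lia.
rewrite !inE => /and3P[eF /andP[hS hX]].
rewrite eF hX /= !negbK => tS tX'; rewrite tX' andbT negbK in tS.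
exists e; split=> // Y Y0.
have [eY|eY] := boolP (e \in dlt Y); last first.
  suff -> : (F :\ e) :&: dlt Y = F :&: dlt Y.
    by apply: leq_trans (cov _ Y0); apply: demand_enlarge.
  by apply/setP => x; rewrite !inE; case: eqVneq => //= ->;
    rewrite inE in eY; rewrite (negbTE eY) andbF.
have [hY tY] : hd e \in Y /\ tl e \notin Y by move: eY; rewrite inE => /andP.
have cardF : #|F :&: dlt Y| = #|(F :\ e) :&: dlt Y|.+1.
  by rewrite (cardsD1 e) in_setI eF eY setIDAC.
(* The loss of [e] is absorbed by slack at [Y], or by a drop in demand if [S i] misses [Y];
   otherwise [Y] is uncrossed with [X]. *)
have [ltY|] := ltnP (demand S Y) #|F :&: dlt Y|.
  by rewrite -ltnS -cardF; apply: leq_ltn_trans (demand_enlarge _ _ _ _) ltY.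
move=> leY; have {leY} tightY : demand S Y = #|F :&: dlt Y|.
  by apply/eqP; rewrite eqn_leq cov.
have [iY|iY] := boolP [disjoint S i & Y].
  by rewrite -ltnS -cardF -tightY; apply: demand_enlarge_lt.
have XY0 : X :&: Y != set0 by apply/set0Pn; exists (hd e); rewrite inE hX.
have XU0 : X :|: Y != set0 by apply/set0Pn; exists (hd e); rewrite inE hX.
have dsub := card_delta_submod F X Y.
have cI := cov _ XY0; have cU := cov _ XU0.
(* Uncrossing makes [X :&: Y] tight, and it meets [S i], else supermodularity would be strict. It
   omits [tl e], against the minimality of [X]. *)
have crit : critical (X :&: Y).
  apply/and3P; split.
  - by have := demand_supermod S X Y; move: cI cU dsub tX tightY; clear; lia.
  - apply/negP => iXY; have := demand_supermod_lt iX iY iXY.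
    by move: cI cU dsub tX tightY; clear; lia.
  - by apply/subsetPn; exists (hd e); rewrite // inE hX.
have := minX _ crit (subsetIl X Y) => /setP/(_ (tl e)).
by rewrite inE tX' (negbTE tY).
Qed.

Lemma edmonds F S (T : 'I_k -> {set A}) :
    (forall i, grown (S i) (T i)) ->
    (forall i j, i != j -> [disjoint T i & T j]) ->
    (forall i, [disjoint T i & F]) ->
    (forall X, X != set0 -> demand S X <= #|F :&: dlt X|) ->
  exists T' : 'I_k -> {set A},
    [/\ forall i, grown setT (T' i),
        forall i j, i != j -> [disjoint T' i & T' j]
      & forall i, T' i \subset T i :|: F].
Proof.
have [n] := ubnP (\sum_i #|~: S i|).
elim: n => // n IH in F S T *; rewrite ltnS => len gT dT dF cov.
have [/forallP allT|/forallPn[i iT]] := boolP [forall i, S i == setT].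
  exists T; split=> // i; last exact: subsetUl.
  by rewrite -(eqP (allT i)).
have [e [eF te he cov']] := edmonds_step (grown_neq0 (gT i)) iT cov.
pose T1 j := if j == i then e |: T i else T j.
have eT j : e \notin T j by rewrite (disjointFl (dF j) eF).
have [||||T' [gT' dT' sT']] := IH (F :\ e) (enlarge S i (hd e)) T1 _ _ _ _ cov'.
- apply: leq_trans len; rewrite (bigD1 i) //= [ltnRHS](bigD1 i) //=.
  rewrite -addSn; apply: leq_add; last first.
    by apply: leq_sum => j /negbTE ji; rewrite /enlarge ji.
  rewrite /enlarge eqxx; apply: proper_card; apply/properP; split.
    by rewrite setCS subsetUr.
  by exists (hd e); rewrite !inE ?eqxx.
- by move=> j; rewrite /enlarge /T1; case: eqVneq => [_|_]; [apply: GrownS|].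
- have dU j : j != i -> [disjoint e |: T i & T j].
    move=> ji; rewrite -setI_eq0 setIUl setU_eq0 [_ :&: _ == _]setI_eq0.
    by rewrite disjoints1 eT setI_eq0 dT // eq_sym.
  move=> j l; rewrite /T1; case: (eqVneq j i) => [->|ji].
    by rewrite eq_sym => li; rewrite (negbTE li) dU.
  case: (eqVneq l i) => [_ _|li]; last exact: dT.
  by rewrite disjoint_sym dU.
- move=> j; rewrite /T1; case: eqVneq => [_|_]; last first.
    by apply: disjointWr (dF j); apply: subsetDl.
  rewrite -setI_eq0 setIUl setU_eq0 [_ :&: _ == _]setI_eq0 disjoints1 !inE eqxx.
  by rewrite setI_eq0; apply: disjointWr (dF i); apply: subsetDl.
exists T'; split=> // j; apply: subset_trans (sT' j) _; rewrite /T1.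
by apply/subsetP => x; case: (eqVneq j i) => [->|_]; rewrite !inE;
  case: (eqVneq x e) => //= ->; rewrite eF orbT.
Qed.

End Edmonds.

End Digraph.

(** * Matroid-restricted [k]-arborescences and the subpartition condition *)

Theorem theorem3p1 (V A : finType) (D : digraph V A) (k : nat) (hk : 0 < k)
    (M : forall v : V, matroid (delta_in D [set v])) :
  (exists F : {set A}, k_arborescence D k F /\ matroid_restricted M F) <->
  (forall P : {set {set V}}, subpartition P ->
     (((\sum_(X in P) rk_sum M (delta_in D X))%N : int)
        >= (k : int) * ((#|P| : int) - 1))%R).
Proof.
have natE (P : {set {set V}}) (n : nat) :
    ((n : int) >= (k : int) * ((#|P| : int) - 1))%R = (k * #|P| <= k + n).
  by rewrite GRing.mulrBr GRing.mulr1 Num.Theory.lerBlDl -PoszM -PoszD lez_nat.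
split=> [[F [[T [sT dT defF]] iF]] P sP|H].
  rewrite natE.
  (* By independence the arcs of [F] entering [X] have rank equal to their number; none of them is a
     loop. *)
  have rkF X : \sum_i #|T i :&: delta_in D X| <= rk_sum M (delta_in D X).
    have -> : \sum_i #|T i :&: delta_in D X| = #|F :&: delta_in D X|.
      rewrite defF card_setI_sum partition_disjoint_bigcup //.
      by apply: eq_bigr => i _; rewrite card_setI_sum.
    apply: leq_trans (rk_sum_mono M (subsetIr F _)).
    have iFX := matroid_restricted_sub (subsetIl F (delta_in D X)) iF.
    rewrite /rk_sum (eq_bigr (fun v =>
      #|F :&: delta_in D X :&: delta_in D [set v]|)); last first.
      by move=> v _; have /andP[_ /eqP] := iFX v.
    rewrite sum_card_delta; apply: subset_leq_card; apply/subsetP => a aFX.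
    rewrite inE aFX; move: aFX; rewrite !inE => /and3P[_ hX].
    by apply: contraNneq => ->.
  apply: (@leq_trans (k + \sum_(X in P) \sum_i #|T i :&: delta_in D X|));
    last by rewrite leq_add2l; apply: leq_sum.
  rewrite exchange_big /=.
  have : \sum_(i < k) #|P| <=
         \sum_(i < k) (1 + \sum_(X in P) #|T i :&: delta_in D X|).
    by apply: leq_sum => i _; apply: subpartition_entered.
  by rewrite big_split /= !sum_nat_const card_ord muln1.
(* Without vertices there are no [k] roots to choose, but [k] empty arborescences will do. *)
have [v0|V0] := pickP (@predT V); last first.
  have noA (a : A) : False by have := V0 (Defs.head D a).
  exists set0; split; last first.
    by move=> v; have := V0 v.
  exists (fun=> set0); split=> [i|i j _|]; last first.
  - by apply/setP => a; case: (noA a).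
  - by rewrite -setI_eq0 set0I.
  - split=> [|v]; last by rewrite set0I cards0.
    split=> [u|]; first by have := V0 u.
    by case=> [//|[a b] c]; case: (noA a).
move=> _; pose f X := rk_sum M (delta_in D X).
have [|P /H|s /coversP cs les] := @covers_small V k f.
- by move=> X Y _; apply: rk_sum_delta_submod.
- by rewrite natE.
(* No arc enters [setT], so covering it takes at least [k] roots. *)
have ks : size s == k.
  rewrite eqn_leq les /=.
  have := cs setT; rewrite /f delta_inT.
  have -> : count (mem [set: V]) s = size s.
    by rewrite -[RHS](count_predT s); apply: eq_count => v /=; rewrite inE.
  have := rk_sum_card M set0; rewrite cards0 leqn0 => /eqP -> ; apply.
  by apply/set0Pn; exists v0.
have [|F rF covF] := @independent_cover _ _ D M k (fun X => count (mem X) s) _ cs.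
  by move=> X Y; rewrite count_setUI.
pose t := Tuple ks.
have [||||T' [gT' dT' sT']] :=
  @edmonds _ _ D k F (fun i => [set tnth t i]) (fun=> set0).
- by move=> i; apply: Grown1.
- by move=> i j _; rewrite -setI_eq0 set0I.
- by move=> i; rewrite -setI_eq0 set0I.
(* Initially [demand] counts the positions whose root is outside [X]: [k] minus the roots in [X],
   with multiplicity. *)
- move=> X /covF; have -> : count (mem X) s = #|[set i | tnth t i \in X]|.
    rewrite -sum1_count (big_tuple _ _ t) -sum1_card.
    by apply: eq_bigl => i; rewrite inE.
  rewrite -[leqLHS]card_ord -(cardsC [set i | tnth t i \in X]) addnC leq_add2r.
  apply: leq_trans; apply: subset_leq_card; apply/subsetP => i.
  by rewrite !inE disjoints1.
exists (\bigcup_i T' i); split.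
  by exists T'; split=> // i; apply: grown_spanning.
apply: (matroid_restricted_sub (F := F)); last exact: matroid_restrictedP.
by apply/bigcupsP => i _; have := sT' i; rewrite set0U.
Qed.
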